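(* Let $d\in\mathbb N$, let $\boldsymbol T=(T_1,\ldots,T_d)$ be a doubly contractive operator tuple on a complex Hilbert space $\mathcal H$ and let $p\in\mathbb C[z_1,\ldots,z_d]$ be a homogeneous polynomial of degree $2$ in $d$ variables. Then $\|p(\boldsymbol T)\|\le\|p\|_\infty$.
   Context: A commuting $d$-tuple $(T_1,\ldots,T_d)$ of bounded linear operators on a Hilbert space $\mathcal H$ is a doubly contractive operator tuple if $\sum_{j=1}^dT_j^*T_j\le I$ and $\sum_{j=1}^dT_jT_j^*\le I$. Here $\|p\|_\infty=\sup\{|p(z)|:z\in\mathbb B_d\}$, where $\mathbb B_d$ is the open Euclidean unit ball of $\mathbb C^d$. *)

(* Defs.v *)
From HB Require Import structures.
From mathcomp Require Import all_boot all_order all_algebra.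
From mathcomp Require Import complex.
(* The notations of mpoly are incompatible with those of normedtype. *)
From mathcomp Require Import -(notations) mpoly.
From mathcomp Require Import boolp classical_sets reals topology normedtype.

Set Implicit Arguments.
Unset Strict Implicit.
Unset Printing Implicit Defensive.

Import Order.TTheory GRing.Theory Num.Theory.
Import numFieldNormedType.Exports.

Local Open Scope classical_set_scope.
Local Open Scope ring_scope.

(* A complex Hilbert space, over the complex field R[i] of an arbitrary
   R : realType, is a complete normed R[i]-module H together with an inner
   product ip : {dot H for Num.conj} (linear in its first argument, conjugate
   linear in its second one, positive definite) that induces the norm of H.
   Norms take their values in R[i], where they are nonnegative reals;
   complex.Re only moves them into R, where sup is available. *)

Section Operators.
Context (R : realType) (H : completeNormedModType R[i]).
Implicit Types (ip : {dot H for (@Num.conj R[i])}) (A B : H -> H).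

Definition induces_norm ip : Prop := forall x : H, `|x| ^+ 2 = ip x x.

Definition bounded_operator A : Prop :=
  exists M : R[i], forall x : H, `|A x| <= M * `|x|.

(* The Hilbert space adjoint: A^* y is the (unique, by nondegeneracy) vector
   representing the functional x |-> <A x, y>.  It exists whenever A is linear
   and bounded, by the Riesz theorem; the default value 0 is then not used. *)
Definition adjoint ip A : H -> H :=
  fun y => xget 0 [set z : H | forall x : H, ip (A x) y = ip x z].

(* A <= B in the order of self-adjoint operators: B - A is positive.
   In R[i], 0 <= c says that c is a nonnegative real. *)
Definition operator_le ip A B : Prop := forall x : H, 0 <= ip (B x - A x) x.

(* sup is 0 on unbounded sets, but the set below is bounded as soon as A is a
   bounded operator. *)
Definition operator_norm A : R :=
  sup [set complex.Re `|A x| | x in [set x : H | `|x| <= 1]].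

Definition doubly_contractive ip (d : nat) (T : 'I_d -> {linear H -> H}) :
    Prop :=
  [/\ forall j, bounded_operator (T j),
      forall j k (x : H), T j (T k x) = T k (T j x),
      operator_le ip (fun x => \sum_(j < d) adjoint ip (T j) (T j x)) id &
      operator_le ip (fun x => \sum_(j < d) T j (adjoint ip (T j) x)) id].

(* T^m = T_0^(m 0) o ... o T_(d-1)^(m (d-1)); the order of composition is
   immaterial for a commuting tuple. *)
Definition operator_monomial (d : nat) (T : 'I_d -> H -> H)
    (m : multinom d) : H -> H :=
  \big[(fun f g : H -> H => f \o g)/id]_(j < d) iter (m j) (T j).

Definition operator_polynomial (d : nat) (p : mpoly d R[i])
    (T : 'I_d -> H -> H) : H -> H :=
  fun x => \sum_(m <- msupp p)
             mcoeff m p *: operator_monomial T m x.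

End Operators.

Definition polynomial_sup_norm (R : realType) (d : nat)
    (p : mpoly d R[i]) : R :=
  sup [set complex.Re `|meval z p|
      | z in [set z : 'I_d -> R[i] | \sum_(j < d) `|z j| ^+ 2 < 1]].

(* Main.v *)
Require Import Defs.
From mathcomp Require Import all_boot all_order all_algebra.
From mathcomp Require Import complex.
From mathcomp Require Import -(notations) mpoly.
From mathcomp Require Import boolp classical_sets reals topology normedtype.
From mathcomp Require Import ring lra.

Import Order.TTheory GRing.Theory Num.Theory.
Import numFieldNormedType.Exports.
Local Open Scope ring_scope.

(** Write $p(z) = \sum_{j,k} a_{jk} z_j z_k$ with a symmetric matrix $A$, and let
    $N$ exceed the sup norm of $p$ on the ball.

    For symmetric $A$ the quadratic form controls the bilinear form by
    polarization: $4 x^T A y = q(x+y) - q(x-y)$, and the parallelogram law turns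
    $|q(z)| \le N |z|^2$ into $|x^T A y| \le N |x| |y|$.  Taking $x$ proportional
    to the conjugate of $A y$ yields $|A y| \le N |y|$
    ([matrix_bound_of_quadratic_form]).  The same bound then holds for families of
    vectors of any inner product space in place of families of scalars: the
    difference $N^2 I - A^* A$ is positive, and a positive matrix paired with a
    Gram matrix gives a nonnegative number, as diagonalizing the former shows
    ([psd_gram], [matrix_family_bound]).

    Put $y = p(T) x$, $w_j = \sum_k a_{jk} T_k x$ and $v_j = T_j^* y$.  Then
    $\sum_j \langle w_j, v_j \rangle = \langle p(T) x, y \rangle = |y|^2$.
    The column contraction bounds $\sum_j |w_j|^2$ by $N^2 |x|^2$, and the row
    contraction bounds $\sum_j |v_j|^2$ by $|y|^2$, so expanding
    $0 \le \sum_j |w_j - v_j|^2$ leaves $|y|^2 \le N^2 |x|^2$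
    ([quadratic_tuple_bound]).  Degree $2$ is what lets one factor of each monomial
    act on $x$ and the other, through its adjoint, on $y$.

    Moving $T_j$ to the other side of the inner product requires the adjoints to
    exist, which is the Riesz representation theorem ([riesz_representation]). *)

(** * Symmetric matrices and their quadratic forms *)

Lemma sum_normsqD_normsqB (C : numClosedFieldType) (n : nat)
    (x y : 'I_n -> C) :
  \sum_j `|x j + y j| ^+ 2 + \sum_j `|x j - y j| ^+ 2 =
  2 * (\sum_j `|x j| ^+ 2 + \sum_j `|y j| ^+ 2).
Proof.
rewrite -!big_split mulr_sumr; apply: eq_bigr => j _ /=.
by rewrite !normCK !rmorphD rmorphN /=; ring.
Qed.

Lemma symmetric_polarization (C : numClosedFieldType) (n : nat) (A : 'M[C]_n)
    (Asym : A^T = A) (x y : 'I_n -> C) :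
  4 * (\sum_j \sum_k A j k * (x j * y k)) =
  \sum_j \sum_k A j k * ((x j + y j) * (x k + y k)) -
  \sum_j \sum_k A j k * ((x j - y j) * (x k - y k)).
Proof.
have -> : 4 * (\sum_j \sum_k A j k * (x j * y k)) =
  2 * (\sum_j \sum_k A j k * (x j * y k)) +
  2 * (\sum_k \sum_j A j k * (x j * y k)).
  by rewrite [X in _ + 2 * X]exchange_big /=; ring.
rewrite !mulr_sumr -big_split -sumrB; apply: eq_bigr => j _ /=.
rewrite !mulr_sumr -big_split -sumrB; apply: eq_bigr => k _ /=.
have -> : A k j = A j k by rewrite -[in LHS]Asym mxE.
by ring.
Qed.

(** Polarization, tested against the conjugate of $A y$ divided by $N$: with this
    scaling both terms of the parallelogram law have the same weight, and half of
    the left-hand side is absorbed. *)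
Lemma matrix_bound_of_quadratic_form (C : numClosedFieldType) (n : nat) (A : 'M[C]_n)
    (N : C) (Asym : A^T = A) (N0 : 0 < N)
    (hA : forall z : 'I_n -> C,
      `|\sum_j \sum_k A j k * (z j * z k)| <= N * \sum_j `|z j| ^+ 2)
    (y : 'I_n -> C) :
  \sum_j `|\sum_k A j k * y k| ^+ 2 <= N ^+ 2 * \sum_k `|y k| ^+ 2.
Proof.
pose w j := \sum_k A j k * y k.
(* This x makes x^T A y equal to |A y|^2 / N. *)
pose x j := (w j)^* / N.
have NJ : N^* = N by apply/CrealP; rewrite ger0_real // ltW.
have wx j : `|w j| ^+ 2 = N ^+ 2 * `|x j| ^+ 2.
  by rewrite normf_div norm_conjC (gtr0_norm N0) expr_div_n mulrC divfK //
    expf_neq0 // gt_eqF.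
have key : 4 * \sum_j `|w j| ^+ 2 = N * (4 * (\sum_j \sum_k A j k * (x j * y k))).
  rewrite mulrCA; congr (_ * _); rewrite mulr_sumr; apply: eq_bigr => j _.
  rewrite normCK {1}/w mulr_suml mulr_sumr; apply: eq_bigr => k _.
  by rewrite /x; field; rewrite gt_eqF.
have : 4 * \sum_j `|w j| ^+ 2 <=
    N * (N * (2 * (\sum_j `|x j| ^+ 2 + \sum_j `|y j| ^+ 2))).
  rewrite -[X in X <= _]ger0_norm; last first.
    by rewrite mulr_ge0 ?ler0n // sumr_ge0 // => j _; rewrite exprn_ge0.
  rewrite key symmetric_polarization // normrM (gtr0_norm N0) ler_pM2l //.
  rewrite -sum_normsqD_normsqB mulrDr; apply: le_trans (ler_normB _ _) _.
  by rewrite lerD.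
have -> : \sum_j `|x j| ^+ 2 = N ^- 2 * \sum_j `|w j| ^+ 2.
  rewrite mulr_sumr; apply: eq_bigr => j _.
  by rewrite wx mulrA mulVf ?mul1r // expf_neq0 // gt_eqF.
set W := \sum_j `|w j| ^+ 2; set Y := \sum_j `|y j| ^+ 2.
have -> : N * (N * (2 * (N ^- 2 * W + Y))) = 2 * W + 2 * (N ^+ 2 * Y).
  by field; rewrite gt_eqF.
rewrite (_ : 4 * W = 2 * W + 2 * W); last by ring.
by rewrite lerD2l ler_pM2l // ltr0n.
Qed.

(** * Positive matrices against Gram matrices *)

Section PositiveMatrices.
Local Open Scope sesquilinear_scope.

(** For $K = P^* D P$ with $D \ge 0$ diagonal, the sum is
    $\sum_i d_i |\sum_k P_{ik} u_k|^2$. *)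
Lemma psd_gram (C : numClosedFieldType) (V : lmodType C)
    (form : {dot V for (@Num.conj C)}) (n : nat) (K : 'M[C]_n)
    (Kherm : K^t* = K)
    (Kpos : forall y : 'I_n -> C, 0 <= \sum_j \sum_k (y j)^* * K j k * y k)
    (u : 'I_n -> V) :
  0 <= \sum_j \sum_k K j k * form (u k) (u j).
Proof.
pose P := spectralmx K; pose D := spectral_diag K.
have Punit : P \is unitarymx := spectral_unitarymx K.
have KE : K = P^t* *m diag_mx D *m P.
  rewrite -invmx_unitary //; apply/orthomx_spectralP.
  by apply/normalmxP; rewrite Kherm.
have DE : diag_mx D = P *m K *m P^t*.
  by rewrite KE !mulmxA mulmxtVK // (unitarymxP _) ?mul1mx.
(* The i-th eigenvalue is the value of K at the conjugate of row i of P. *)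
have D0 i : 0 <= D 0 i.
  have -> : D 0 i = \sum_j \sum_k ((P i j)^*)^* * K j k * (P i k)^*.
    have -> : D 0 i = (diag_mx D) i i by rewrite !mxE eqxx.
    rewrite DE -mulmxA mxE; apply: eq_bigr => j _.
    rewrite mxE mulr_sumr; apply: eq_bigr => k _.
    by rewrite !mxE conjCK mulrA.
  exact: Kpos.
suff -> : \sum_j \sum_k K j k * form (u k) (u j) =
  \sum_i D 0 i * form (\sum_k P i k *: u k) (\sum_j P i j *: u j).
  by apply: sumr_ge0 => i _; rewrite mulr_ge0 // dnorm_ge0.
under [RHS]eq_bigr do rewrite linear_sumlz mulr_sumr.
rewrite exchange_big /= [RHS]exchange_big /=; apply: eq_bigr => k _.
under [RHS]eq_bigr do rewrite raddf_sum mulr_sumr.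
rewrite [RHS]exchange_big; apply: eq_bigr => j _ /=.
rewrite KE -mulmxA mxE mulr_suml; apply: eq_bigr => i _.
rewrite linearZl_LR linearZr_LR /= mul_diag_mx !mxE; ring.
Qed.

(** This is the inequality of norms of $A \otimes I$ and $A$, up to squaring: the
    hypothesis says that $c I - A^* A$ is positive, and [psd_gram] transports its
    positivity from scalars to vectors. *)
Lemma matrix_family_bound (C : numClosedFieldType) (V : lmodType C)
    (form : {dot V for (@Num.conj C)}) (n : nat) (A : 'M[C]_n) (c : C)
    (creal : c^* = c)
    (hA : forall y : 'I_n -> C,
      \sum_j `|\sum_k A j k * y k| ^+ 2 <= c * \sum_k `|y k| ^+ 2)
    (u : 'I_n -> V) :
  \sum_j form (\sum_k A j k *: u k) (\sum_k A j k *: u k) <=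
  c * \sum_k form (u k) (u k).
Proof.
pose K : 'M[C]_n := c%:M - A^t* *m A.
have Kherm : K^t* = K.
  rewrite /K linearB map_mxB /= trmx_mul map_mxM -!map_trmx trmxK.
  rewrite map_scalar_mx /= creal tr_scalar_mx -map_mx_comp.
  by rewrite (map_mx_id (@conjCK _)).
have KE j k : K j k = c *+ (j == k) - \sum_i (A i j)^* * A i k.
  by rewrite !mxE; congr (_ - _); apply: eq_bigr => i _; rewrite !mxE.
(* The scalar inequality, for F j k = y_k (y_j)^*, and the vector inequality, for
   F j k = <u_k, u_j>, are two instances of one expansion. *)
have diag (F : 'I_n -> 'I_n -> C) :
    \sum_j \sum_k K j k * F j k =
    c * (\sum_j F j j) - \sum_i \sum_j \sum_k (A i j)^* * A i k * F j k.
  rewrite [X in _ - X]exchange_big /= mulr_sumr -sumrB; apply: eq_bigr => j _.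
  under eq_bigr do rewrite KE mulrBl.
  rewrite sumrB; congr (_ - _).
    rewrite (bigD1 j) //= eqxx mulr1n big1 ?addr0 // => k.
    by rewrite eq_sym => /negbTE ->; rewrite mul0r.
  by rewrite [RHS]exchange_big; apply: eq_bigr => k _; rewrite mulr_suml.
rewrite -subr_ge0.
suff <- : \sum_j \sum_k K j k * form (u k) (u j) =
  c * (\sum_k form (u k) (u k)) -
  \sum_j form (\sum_k A j k *: u k) (\sum_k A j k *: u k).
  apply: psd_gram => // y.
  suff -> : \sum_j \sum_k (y j)^* * K j k * y k =
    c * (\sum_k `|y k| ^+ 2) - \sum_j `|\sum_k A j k * y k| ^+ 2.
    by rewrite subr_ge0.
  have -> : \sum_j \sum_k (y j)^* * K j k * y k =
      \sum_j \sum_k K j k * (y k * (y j)^*).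
    by apply: eq_bigr => j _; apply: eq_bigr => k _; ring.
  rewrite diag; congr (_ * _ - _).
    by apply: eq_bigr => k _; rewrite normCK.
  apply: eq_bigr => i _; rewrite normCK rmorph_sum mulr_sumr.
  apply: eq_bigr => j _; rewrite mulr_suml; apply: eq_bigr => k _.
  by rewrite rmorphM /=; ring.
rewrite diag; congr (_ - _).
apply: eq_bigr => i _; rewrite linear_sumlz exchange_big.
apply: eq_bigr => k _; rewrite raddf_sum; apply: eq_bigr => j _.
by rewrite /= linearZl_LR linearZr_LR /=; ring.
Qed.

End PositiveMatrices.

(** * The Riesz representation theorem and adjoints *)

Lemma dotC (C : numClosedFieldType) (V : lmodType C)
    (form : {dot V for (@Num.conj C)}) (u v : V) : form u v = (form v u)^*.
Proof. by rewrite hermC mul1r. Qed.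

(** Expand the square norm of $\langle v,v \rangle u - \langle u,v \rangle v$. *)
Lemma dot_CauchySchwarz (C : numClosedFieldType) (V : lmodType C)
    (form : {dot V for (@Num.conj C)}) (u v : V) :
  `|form u v| ^+ 2 <= form u u * form v v.
Proof.
have [->|v0] := eqVneq v 0; first by rewrite !linear0r normr0 expr0n mulr0.
have vv : 0 < form v v by rewrite dnorm_gt0.
have vvJ : (form v v)^* = form v v by rewrite -dotC.
rewrite -subr_ge0 -(pmulr_rge0 _ vv).
have := dnorm_ge0 form (form v v *: u - form u v *: v).
congr (0 <= _); rewrite dnormB !dnormZ linearZl_LR linearZr_LR /=.
by rewrite (ger0_norm (ltW vv)) !rmorphM /= conjCK vvJ normCK; ring.
Qed.

Section Riesz.
Local Open Scope classical_set_scope.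
Context (R : realType) (H : completeNormedModType R[i]).
Context (ip : {dot H for (@Num.conj R[i])}) (hip : induces_norm ip).
Context (f : H -> R[i]) (flin : scalar f).
Context (M : R[i]) (fM : forall x, `|f x| <= M * `|x|).

(* The functional |z|^2 - 2 Re (f z) equals |z - z0|^2 - |z0|^2 when z0 represents
   f, so that z0 is its minimizer.  It is taken in R, where infima exist. *)
Let J z := complex.Re (ip z z - (f z + (f z)^*)).

Let fD x y : f (x + y) = f x + f y.
Proof. by have := flin 1 x y; rewrite scale1r mul1r. Qed.

Let f0 : f 0 = 0.
Proof. by apply: (@addrI _ (f 0)); rewrite -fD !addr0. Qed.

Let fZ a x : f (a *: x) = a * f x.
Proof. by have := flin a x 0; rewrite f0 !addr0. Qed.

Let JE z : (J z)%:C%C = ip z z - (f z + (f z)^*).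
Proof.
apply: RRe_real; apply: rpredB; first by rewrite ger0_real // dnorm_ge0.
by apply/CrealP; rewrite rmorphD /= conjCK addrC.
Qed.

Let J_lb z : - (complex.Re (`|M| ^+ 2)) <= J z.
Proof.
have KE : (complex.Re (`|M| ^+ 2))%:C%C = `|M| ^+ 2.
  by apply: RRe_real; rewrite ger0_real // exprn_ge0.
set K := complex.Re _ in KE *; rewrite -subr_ge0 opprK -ler0c rmorphD /= JE KE.
have fz : f z + (f z)^* <= 2 * (`|M| * `|z|).
  have -> : f z + (f z)^* = 2 * 'Re (f z).
    by rewrite ReE mulrC divfK // pnatr_eq0.
  rewrite ler_pM2l ?ltr0n //; apply: le_trans (leif_Re_Creal _) _.
  apply: le_trans (fM z) _.
  rewrite -[X in X <= _]ger0_norm ?normrM ?normr_id //.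
  exact: le_trans (fM z).
have : 0 <= (`|z| - `|M|) ^+ 2.
  by rewrite real_exprn_even_ge0 // rpredB // normr_real.
rewrite -hip => sq0; apply: le_trans sq0 _.
rewrite sqrrB -subr_ge0.
have -> : `|z| ^+ 2 - (f z + (f z)^*) + `|M| ^+ 2 -
  (`|z| ^+ 2 - `|z| * `|M| *+ 2 + `|M| ^+ 2) =
  2 * (`|M| * `|z|) - (f z + (f z)^*) by ring.
by rewrite subr_ge0.
Qed.

Let J_inf : has_inf (range J).
Proof.
split; first by exists (J 0); exists 0.
by exists (- (complex.Re (`|M| ^+ 2))) => _ [z _ <-]; apply: J_lb.
Qed.

Let m := inf (range J).

Let m_le z : m <= J z.
Proof. by apply: ge_inf; [case: J_inf|exists z]. Qed.

(* Near-minimizers are close to each other, because J at their midpoint is at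
   least the infimum. *)
Let parallelogram x y :
  `|x - y| ^+ 2 = 2 * (J x)%:C%C + 2 * (J y)%:C%C - 4 * (J (2^-1 *: (x + y)))%:C%C.
Proof.
rewrite hip !JE dnormB dnormZ dnormD fZ fD !rmorphM !rmorphD /= fmorphV /=.
rewrite normfV normr_nat rmorph_nat.
by field.
Qed.

Let J_step y t h : let g := f h - ip h y in
  (J (y + t *: h))%:C%C = (J y)%:C%C + `|t| ^+ 2 * `|h| ^+ 2 - (t * g + (t * g)^*).
Proof.
rewrite /= !JE hip dnormD dnormZ fD fZ linearZr_LR /= (dotC _ _ ip y h).
by rewrite !rmorphM !rmorphD rmorphN /= !conjCK; ring.
Qed.

(* A near-minimizer y nearly represents f: otherwise a step from y along h would
   bring J below its infimum.  The step t = g^* / (|h|^2 + 1), for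
   g = f h - <h, y>, decreases J by at least |g|^2 / (|h|^2 + 1). *)
Let nearly_stationary y h (e : R) : J y < m + e ->
  `|f h - ip h y| ^+ 2 <= (`|h| ^+ 2 + 1) * e%:C%C.
Proof.
move=> ye.
have c0 : 0 < `|h| ^+ 2 + 1 by rewrite ltr_wpDl // exprn_ge0.
set c := `|h| ^+ 2 + 1 in c0 *; set g := f h - ip h y.
have cJ : c^* = c by apply/CrealP; rewrite ger0_real // ltW.
have := m_le (y + (g^* / c) *: h).
rewrite -lecR J_step -/g => mJ.
have lt1 : (J y)%:C%C < (m + e)%:C%C by rewrite ltcR.
have : m%:C%C < (m + e)%:C%C + `|g^* / c| ^+ 2 * `|h| ^+ 2 -
   (g^* / c * g + (g^* / c * g)^*).
  by apply: le_lt_trans mJ _; rewrite -!addrA ltrD2r.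
rewrite rmorphD /= -!addrA -subr_gt0 => pos.
have : `|g| ^+ 2 / c < e%:C%C.
  rewrite -subr_gt0; apply: lt_le_trans pos _.
  rewrite normf_div norm_conjC (gtr0_norm c0) !rmorphM /= conjCK fmorphV /= cJ.
  rewrite (_ : `|h| ^+ 2 = c - 1); last by rewrite /c addrK.
  rewrite -subr_ge0.
  have -> : e%:C%C - `|g| ^+ 2 / c - (m%:C%C + (e%:C%C +
      ((`|g| / c) ^+ 2 * (c - 1) - (g^* / c * g + g / c * g^*))) - m%:C%C) =
      `|g| ^+ 2 / c ^+ 2.
    rewrite (_ : g^* / c * g = `|g| ^+ 2 / c); last by rewrite normCK; ring.
    rewrite (_ : g / c * g^* = `|g| ^+ 2 / c); last by rewrite normCK; ring.
    by field; rewrite gt_eqF.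
  by rewrite divr_ge0 ?exprn_ge0 // ltW.
by rewrite ltr_pdivrMr // => /ltW; rewrite mulrC.
Qed.

(* Minimization along the filter of near-minimizers avoids choosing a sequence. *)
Let F := filter_from [set e : R | 0 < e] (fun e => [set z | J z < m + e]).

Let F_proper : ProperFilter F.
Proof.
apply: filter_from_proper => [|e e0]; last first.
  by have [_ [z _ <-] ze] := inf_adherent e0 J_inf; exists z.
apply: filter_from_filter; first by exists 1; apply: ltr01.
move=> a b a0 b0; exists (Num.min a b); first by rewrite /= lt_min a0.
by move=> z /=; rewrite -!ltrBlDl lt_min => /andP[].
Qed.

Let F_cauchy : cauchy F.
Proof.
have FF : Filter F := @filter_filter _ _ F_proper.
apply: cauchy_exP => e e0.
have eC : (complex.Re (e ^+ 2 / 4))%:C%C = e ^+ 2 / 4.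
  by apply: RRe_real; rewrite ger0_real // divr_ge0 // exprn_ge0 // ltW.
have d0 : 0 < complex.Re (e ^+ 2 / 4).
  by rewrite -ltcR eC divr_gt0 // exprn_gt0.
set d := complex.Re _ in eC d0.
have [_ [x _ <-] xd] := inf_adherent d0 J_inf.
exists x; exists d => // y /= yd.
rewrite -ball_normE /ball_ /= -(@ltr_pXn2r _ 2) ?nnegrE // ?(ltW e0) //.
rewrite parallelogram.
have -> : e ^+ 2 = (4 * d)%:C%C.
  rewrite rmorphM /= eC rmorph_nat mulrC divfK //.
  by rewrite pnatr_eq0.
set Jm := J (2^-1 *: _); have Jm_ge : m <= Jm by apply: m_le.
rewrite (_ : _ - _ = (2 * J x + 2 * J y - 4 * Jm)%:C%C); last first.
  by rewrite rmorphB rmorphD !rmorphM /= !rmorph_nat.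
move: xd yd; rewrite -/m ltcR /=; lra.
Qed.

Lemma riesz_representation : exists z, forall h, f h = ip h z.
Proof.
have Fz : F --> lim F := @cauchy_cvg _ F F_proper F_cauchy.
set z := lim F in Fz; exists z => h.
have bound (e : R) : 0 < e ->
    `|f h - ip h z| ^+ 2 <= 4 * (`|h| ^+ 2 + 1) * e%:C%C.
  move=> e0.
  have e0' : 0 < sqrtC e%:C%C by rewrite sqrtC_gt0 ltcR.
  have [y [/= ye zy]] :
      exists y, [set y | J y < m + e] y /\ ball z (sqrtC e%:C%C) y.
    apply: (@filter_ex _ F F_proper).
    apply: (@filterI _ F (@filter_filter _ _ F_proper)); first by exists e.
    by apply: Fz; apply: nbhsx_ballx.
  have zye : `|z - y| ^+ 2 <= e%:C%C.
    rewrite -[X in _ <= X]sqrtCK ler_sqr ?nnegrE // ?(ltW e0') // ltW //.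
    by move: zy; rewrite -ball_normE.
  have h1 := nearly_stationary y h e ye.
  have h2 := dot_CauchySchwarz _ _ ip h (y - z).
  have -> : f h - ip h z = (f h - ip h y) + ip h (y - z).
    by rewrite linearBr /=; ring.
  have c0 : 0 <= `|h| ^+ 2 by rewrite exprn_ge0.
  have c1 : 0 <= `|h| ^+ 2 + 1 by rewrite addr_ge0.
  have e0C : 0 <= e%:C%C by rewrite ler0c ltW.
  have h3 : `|ip h (y - z)| ^+ 2 <= (`|h| ^+ 2 + 1) * e%:C%C.
    apply: le_trans h2 _; rewrite -!hip distrC.
    by rewrite ler_pM ?exprn_ge0 // lerDl.
  apply: (@le_trans _ _ (2 * (`|f h - ip h y| ^+ 2 + `|ip h (y - z)| ^+ 2))).
    rewrite -subr_ge0.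
    have -> : forall a b : R[i], 2 * (`|a| ^+ 2 + `|b| ^+ 2) - `|a + b| ^+ 2 =
        `|a - b| ^+ 2.
      by move=> a b; rewrite !normCK !rmorphD rmorphN /=; ring.
    exact: exprn_ge0.
  rewrite (_ : 4 * _ * _ =
    2 * ((`|h| ^+ 2 + 1) * e%:C%C + (`|h| ^+ 2 + 1) * e%:C%C)); last by ring.
  by rewrite ler_pM2l ?ltr0n // lerD.
pose G := `|f h - ip h z| ^+ 2.
have G0 : 0 <= G by rewrite exprn_ge0.
suff /eqP : G = 0 by rewrite sqrf_eq0 normr_eq0 subr_eq0 => /eqP.
move: bound; rewrite -/G => bound.
set K := 4 * _ in bound.
have K0 : 0 < K by rewrite mulr_gt0 // ltr_wpDl // exprn_ge0.
apply/eqP/negPn/negP => Gn0; have Gpos : 0 < G by rewrite lt_def Gn0.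
have eC : (complex.Re (G / (2 * K)))%:C%C = G / (2 * K).
  by apply: RRe_real; rewrite ger0_real // divr_ge0 // mulr_ge0 // ltW.
have := bound (complex.Re (G / (2 * K))).
rewrite eC -ltcR eC => /(_ (divr_gt0 Gpos (mulr_gt0 (ltr0n _ 2) K0))).
rewrite (_ : K * _ = G / 2); last by field; rewrite gt_eqF.
apply/negP; rewrite -real_ltNge ?ger0_real ?divr_ge0 //.
by rewrite ltr_pdivrMr // ltr_pMr // ltr1n.
Qed.
End Riesz.

Lemma adjointP (R : realType) (H : completeNormedModType R[i])
    (ip : {dot H for (@Num.conj R[i])}) (hip : induces_norm ip)
    (A : {linear H -> H}) (hA : bounded_operator A) (x y : H) :
  ip (A x) y = ip x (adjoint ip A y).
Proof.
have [M AM] := hA.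
suff [z zP] : exists z, forall h, ip (A h) y = ip h z.
  have := @xgetPex _ 0 [set z | forall h, ip (A h) y = ip h z].
  by apply; exists z.
apply: (@riesz_representation R H ip hip (fun h => ip (A h) y) _ (M * `|y|)).
  by move=> a u v; rewrite /= !linearP /= linearDl linearZl_LR.
move=> u; have y0 := normr_ge0 y.
apply: (@le_trans _ _ (`|A u| * `|y|)); last first.
  by rewrite mulrAC ler_wpM2r.
rewrite -ler_sqr ?nnegrE ?mulr_ge0 // exprMn !hip.
exact: dot_CauchySchwarz.
Qed.

(** * Quadratic polynomials in commuting operators *)

Lemma sum_delta (C : numClosedFieldType) (n : nat) (V : lmodType C)
    (c : C) (a b : 'I_n) (G : 'I_n -> 'I_n -> V) :
  \sum_j \sum_k (c *: delta_mx a b : 'M_n) j k *: G j k = c *: G a b.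
Proof.
rewrite (bigD1 a) //= (bigD1 b) //= !mxE !eqxx mulr1.
rewrite big1 ?addr0 => [|k /negbTE kb]; last by rewrite !mxE kb andbF mulr0 scale0r.
rewrite big1 ?addr0 // => j /negbTE ja.
by rewrite big1 // => k _; rewrite !mxE ja mulr0 scale0r.
Qed.

Lemma mdeg2_split (n : nat) (m : multinom n) :
  mdeg m = 2%N -> exists a b, m = mnm_add (mnm1 a) (mnm1 b).
Proof.
move=> m2.
have [a ma] : exists a, m a != 0%N.
  apply/existsP; rewrite -negb_forall; apply/negP => /forallP m0.
  by move: m2; rewrite mdegE big1 // => i _; apply/eqP.
have ma' : mpoly.lem (mnm1 a) m by rewrite lep1mP.
have mE := submK ma'.
have /mdeg1P [b /eqP mb] : mdeg (mnm_sub m (mnm1 a)) == 1%N.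
  by have := congr1 mdeg mE; rewrite mdegD mdeg1 m2 addn1 => -[->].
by exists b, a; rewrite -mb mE.
Qed.

(** Quantifying over all values $G$ of the monomials makes one matrix serve both the
    evaluation at points and the evaluation at operators. *)
Lemma degree2_matrix (C : numClosedFieldType) (n : nat)
    (c : multinom n -> C) (s : seq (multinom n))
    (s2 : forall m, m \in s -> mdeg m = 2%N) :
  exists2 A : 'M[C]_n, A^T = A &
    forall (V : lmodType C) (G : multinom n -> V),
      \sum_(m <- s) c m *: G m =
      \sum_j \sum_k A j k *: G (mnm_add (mnm1 j) (mnm1 k)).
Proof.
elim: s s2 => [|m s IHs] s2.
  exists 0 => [|V G]; first exact: trmx0.
  rewrite big_nil big1 // => j _; rewrite big1 // => k _.
  by rewrite mxE scale0r.
have [|A Asym AE] := IHs.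
  by move=> m' ms; apply: s2; rewrite in_cons ms orbT.
have [a [b mE]] := mdeg2_split _ m (s2 m (mem_head _ _)).
(* A monomial z_a z_b is split evenly between the entries (a, b) and (b, a). *)
exists ((c m / 2) *: delta_mx a b + (c m / 2) *: delta_mx b a + A) => [|V G].
  by rewrite !linearD !linearZ /= !trmx_delta Asym (addrC (_ *: delta_mx b a)).
rewrite big_cons AE.
transitivity (\sum_j \sum_k
  ((c m / 2 *: delta_mx a b : 'M_n) j k *: G (mnm_add (mnm1 j) (mnm1 k)) +
  (c m / 2 *: delta_mx b a : 'M_n) j k *: G (mnm_add (mnm1 j) (mnm1 k)) +
  A j k *: G (mnm_add (mnm1 j) (mnm1 k)))); last first.
  apply: eq_bigr => j _; apply: eq_bigr => k _.
  by rewrite -!scalerDl !mxE.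
under [RHS]eq_bigr do rewrite !big_split.
rewrite !big_split /=.
rewrite !(sum_delta _ _ _ _ _ _ (fun j k => G (mnm_add (mnm1 j) (mnm1 k)))).
rewrite (addmC (mnm1 b)) -mE; congr (_ + _).
by rewrite -scalerDl -splitr.
Qed.

Section OperatorMonomials.
Context (R : realType) (H : completeNormedModType R[i]) (d : nat).
Context (T : 'I_d -> H -> H) (Tcomm : forall j k x, T j (T k x) = T k (T j x)).

Let B (r : seq 'I_d) (m : multinom d) : H -> H :=
  \big[(fun f g : H -> H => f \o g)/id]_(j <- r) iter (m j) (T j).

Lemma operator_monomial_mulU (a : 'I_d) (m : multinom d) (x : H) :
  operator_monomial T (mnm_add (mnm1 a) m) x = T a (operator_monomial T m x).
Proof.
have Ticomm i n y : T a (iter n (T i) y) = iter n (T i) (T a y).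
  by elim: n => //= n IHn; rewrite Tcomm IHn.
(* The list of indices has no repetition, so that T a enters exactly once, and it
   commutes past the factors that come before it. *)
suff BE r : uniq r -> B r (mnm_add (mnm1 a) m) x =
    if a \in r then T a (B r m x) else B r m x.
  by have := BE _ (index_enum_uniq 'I_d); rewrite mem_index_enum; apply.
rewrite /B; elim: r => [|i r IHr] /=; first by rewrite !big_nil.
move=> /andP[ir /IHr {}IHr]; rewrite !big_cons /= IHr in_cons mnmDE mnm1E.
have [ai|ai] /= := eqVneq a i; first by rewrite ai (negbTE ir).
by rewrite add0n; case: ifP; rewrite // Ticomm.
Qed.

Lemma operator_monomial_pair (a b : 'I_d) (x : H) :
  operator_monomial T (mnm_add (mnm1 a) (mnm1 b)) x = T a (T b x).
Proof.
rewrite operator_monomial_mulU -[mnm1 b]addm0 operator_monomial_mulU.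
congr (T _ (T _ _)); rewrite /operator_monomial.
elim/big_ind: _ => //= [f g fx gx|i _]; first by rewrite gx.
by rewrite mnm0E.
Qed.
End OperatorMonomials.

(** By homogeneity, with a limit because the ball is open: $z / \sqrt t$ lies in it
    for every $t > |z|^2$. *)
Lemma quadratic_form_scaling (C : numClosedFieldType) (n : nat) (A : 'M[C]_n)
    (N : C) (N0 : 0 <= N)
    (hA : forall z : 'I_n -> C, \sum_j `|z j| ^+ 2 < 1 ->
      `|\sum_j \sum_k A j k * (z j * z k)| <= N)
    (z : 'I_n -> C) :
  `|\sum_j \sum_k A j k * (z j * z k)| <= N * \sum_j `|z j| ^+ 2.
Proof.
set s := \sum_j `|z j| ^+ 2.
have s0 : 0 <= s by apply: sumr_ge0 => j _; rewrite exprn_ge0.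
apply/ler_addgt0Pr => e e0.
have N1 : 0 < N + 1 by rewrite ltr_wpDl.
pose t := s + e / (N + 1).
have t0 : 0 < t by rewrite ltr_wpDl // divr_gt0.
have r0 : 0 < sqrtC t by rewrite sqrtC_gt0.
have := hA (fun j => z j / sqrtC t).
have -> : \sum_j `|z j / sqrtC t| ^+ 2 = s / t.
  rewrite mulr_suml; apply: eq_bigr => j _.
  by rewrite normf_div (gtr0_norm r0) expr_div_n sqrtCK.
rewrite ltr_pdivrMr // mul1r ltrDl divr_gt0 // => /(_ isT).
have -> : \sum_j \sum_k A j k * (z j / sqrtC t * (z k / sqrtC t)) =
    (\sum_j \sum_k A j k * (z j * z k)) / t.
  rewrite mulr_suml; apply: eq_bigr => j _; rewrite mulr_suml.
  apply: eq_bigr => k _; rewrite -[X in _ = _ / X]sqrtCK.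
  by field; rewrite gt_eqF.
rewrite normf_div (gtr0_norm t0) ler_pdivrMr // => /le_trans; apply.
rewrite mulrDr lerD2l mulrCA ler_piMr ?(ltW e0) //.
by rewrite ler_pdivrMr // mul1r lerDl.
Qed.

Lemma meval_quadratic (C : numClosedFieldType) (n : nat) (p : mpoly n C)
  (A : 'M[C]_n)
  (AE : forall (V : lmodType C) (G : multinom n -> V),
      \sum_(m <- msupp p) mcoeff m p *: G m =
      \sum_j \sum_k A j k *: G (mnm_add (mnm1 j) (mnm1 k)))
  (z : 'I_n -> C) :
  meval z p = \sum_j \sum_k A j k * (z j * z k).
Proof.
transitivity (\sum_(m <- msupp p) mcoeff m p *: (mmap1 z m : C^o)) => //.
rewrite AE; apply: eq_bigr => j _; apply: eq_bigr => k _.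
by rewrite commr_mmap1_M ?mmap1U // => *; apply: mulrC.
Qed.

(** The point is that $p$ is bounded on the ball, by the sum of the moduli of the
    entries of $A$, so that the supremum is a genuine one. *)
Lemma meval_le_sup_norm (R : realType) (n : nat) (p : mpoly n R[i])
  (A : 'M[R[i]]_n)
  (AE : forall z, meval z p = \sum_j \sum_k A j k * (z j * z k))
  (z : 'I_n -> R[i]) (hz : \sum_j `|z j| ^+ 2 < 1) :
  `|meval z p| <= (polynomial_sup_norm p)%:C%C.
Proof.
have normRe (c : R[i]) : (complex.Re `|c|)%:C%C = `|c|.
  by apply: RRe_real; rewrite normr_real.
rewrite -normRe lecR; apply: ub_le_sup; last by exists z.
exists (complex.Re (\sum_j \sum_k `|A j k|)) => _ [w hw <-].
rewrite -lecR normRe RRe_real; last first.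
  by apply: rpred_sum => j _; apply: rpred_sum => k _; rewrite normr_real.
have w1 j : `|w j| <= 1.
  rewrite -(@expr_le1 _ 2) //; apply: le_trans (ltW hw).
  rewrite (bigD1 j) //= lerDl sumr_ge0 // => k _; exact: exprn_ge0.
rewrite AE; apply: le_trans (ler_norm_sum _ _ _) _; apply: ler_sum => j _.
apply: le_trans (ler_norm_sum _ _ _) _; apply: ler_sum => k _.
by rewrite !normrM ler_piMr // mulr_ile1.
Qed.

(** Subtracting the families $w$ and $v$ takes the place of a Cauchy-Schwarz
    inequality for families, because their inner product is $|y|^2$ itself. *)
Lemma quadratic_tuple_bound (R : realType) (H : completeNormedModType R[i])
    (ip : {dot H for (@Num.conj R[i])}) (hip : induces_norm ip)
    (d : nat) (T : 'I_d -> {linear H -> H}) (hT : doubly_contractive ip T)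
    (A : 'M[R[i]]_d) (N : R[i]) (N0 : 0 <= N)
    (hA : forall y : 'I_d -> R[i],
      \sum_j `|\sum_k A j k * y k| ^+ 2 <= N ^+ 2 * \sum_k `|y k| ^+ 2)
    (x : H) :
  `|\sum_j \sum_k A j k *: T j (T k x)| <= N * `|x|.
Proof.
have [Tbd _ Tcol Trow] := hT.
have adj := fun j => @adjointP R H ip hip (T j) (Tbd j).
have adj' j u v : ip (adjoint ip (T j) u) v = ip u (T j v).
  by rewrite dotC -adj -dotC.
have col : \sum_j ip (T j x) (T j x) <= ip x x.
  have := Tcol x; rewrite linearBl linear_sumlz subr_ge0.
  by rewrite (eq_bigr (fun j => ip (T j x) (T j x))) // => j _; apply: adj'.
have row z : \sum_j ip (adjoint ip (T j) z) (adjoint ip (T j) z) <= ip z z.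
  have := Trow z; rewrite linearBl linear_sumlz subr_ge0.
  rewrite (eq_bigr (fun j => ip (adjoint ip (T j) z) (adjoint ip (T j) z))) //.
  by move=> j _; apply: adj.
set y := \sum_j _.
have NJ : (N ^+ 2)^* = N ^+ 2 by apply/CrealP; rewrite ger0_real // exprn_ge0.
have := matrix_family_bound _ _ ip _ _ _ NJ hA (fun k => T k x).
pose w j := \sum_k A j k *: T k x.
pose v j := adjoint ip (T j) y.
rewrite -/(w _) => wle.
have yE : ip y y = \sum_j ip (w j) (v j).
  rewrite {1}/y linear_sumlz; apply: eq_bigr => j _.
  rewrite /v -adj; congr (ip _ _); rewrite linear_sum.
  by apply: eq_bigr => k _; rewrite linearZ.
have yE' : ip y y = \sum_j (ip (w j) (v j))^*.
  by rewrite -rmorph_sum /= -yE; apply: dotC.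
have : 0 <= \sum_j ip (w j - v j) (w j - v j).
  by apply: sumr_ge0 => j _; apply: dnorm_ge0.
under eq_bigr do rewrite dnormB.
rewrite sumrB !big_split /= -yE -yE' subr_ge0 => yle.
rewrite -ler_sqr ?nnegrE ?mulr_ge0 // exprMn !hip.
rewrite -(lerD2r (ip y y)); apply: le_trans yle _; apply: lerD (row y).
by apply: le_trans wle _; rewrite ler_wpM2l ?exprn_ge0.
Qed.

(** * The inequality *)

Theorem proposition3 (R : realType) (H : completeNormedModType R[i])
    (ip : {dot H for (@Num.conj R[i])}) (hip : induces_norm ip)
    (d : nat) (T : 'I_d -> {linear H -> H}) (hT : doubly_contractive ip T)
    (p : mpoly d R[i])
    (hp : p \is ishomog1 2%N (@mdeg d)) :
  operator_norm (operator_polynomial p (fun j => T j))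
    <= polynomial_sup_norm p.
Proof.
have [|A Asym AE] := degree2_matrix _ _ (fun m => mcoeff m p) (msupp p).
  by move: hp => /dhomogP.
have pE := meval_quadratic _ _ _ _ AE.
have pTE x : operator_polynomial p (fun j => T j) x =
    \sum_j \sum_k A j k *: T j (T k x).
  rewrite /operator_polynomial.
  rewrite (AE H (fun m => operator_monomial (fun j => T j) m x)).
  have [_ Tcomm _ _] := hT.
  by apply: eq_bigr => j _; apply: eq_bigr => k _; rewrite operator_monomial_pair.
have ball := meval_le_sup_norm _ _ _ _ pE.
set N := polynomial_sup_norm p in ball *.
have N0 : 0 <= N%:C%C.
  apply: le_trans (ball (fun=> 0) _); first exact: normr_ge0.
  by rewrite big1 // => j _; rewrite normr0 expr0n.
have form_le := quadratic_form_scaling _ _ A _ N0.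
apply: ge_sup.
  exists (complex.Re `|operator_polynomial p (fun j => T j) 0|).
  by exists 0; rewrite //= normr0.
move=> _ [x /= x1 <-]; apply/ler_addgt0Pr => e e0.
have Ne0 : 0 < (N + e)%:C%C.
  by rewrite ltcR ltr_wpDl // -ler0c.
suff : `|operator_polynomial p (fun j => T j) x| <= (N + e)%:C%C.
  by rewrite lecE => /andP[].
(* The slack e provides the positive constant by which the polarization divides. *)
rewrite pTE; apply: le_trans (_ : (N + e)%:C%C * `|x| <= _); last first.
  by rewrite ler_piMr // ltW.
apply: (@quadratic_tuple_bound R H ip hip d T hT A _ (ltW Ne0)).
apply: matrix_bound_of_quadratic_form => // z.
apply: le_trans (form_le _ z) _ => [z' /ball|]; first by rewrite pE.
rewrite ler_wpM2r //; first by apply: sumr_ge0 => j _; rewrite exprn_ge0.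
by rewrite lecR lerDl ltW.
Qed.
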